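(* Let $\Omega \subseteq \mathbb{C}$ be an unbounded domain and let $J \subseteq \partial\Omega$ be a compact set without isolated points. Then the class $$ S(\Omega, J) = \Big\{ f \in \widetilde{R}(\Omega) : \limsup_{\substack{z \to z_0 \\ z \in J \setminus \{z_0\}}} \Big| \frac{f(z) - f(z_0)}{z - z_0} \Big| = +\infty \ \text{ for every } z_0 \in J \Big\} $$ is either empty or a dense $G_\delta$ subset of $\widetilde{R}(\Omega)$.
   Context: A domain is a nonempty connected open subset of $\mathbb{C}$. Closures and boundaries are taken in $\mathbb{C}$ (so $\overline{\Omega}$ does not contain $\infty$). For an unbounded open set $\Omega \subseteq \mathbb{C}$, $\widetilde{R}(\Omega)$ denotes the set of all functions $f : \overline{\Omega} \to \mathbb{C}$ that are uniform limits on each compact subset of $\overline{\Omega}$ of rational functions with poles off $\overline{\Omega}$ (i.e. all poles in $\mathbb{C}$ lie outside $\overline{\Omega}$; a pole at $\infty$ is allowed, so polynomials are included). It is endowed with the topology of uniform convergence on compact subsets of $\overline{\Omega}$, equivalently the topology defined by the seminorms $\sup_{z \in \overline{\Omega},\, |z| \le n} |f(z)|$, $n = 1, 2, \dots$, which makes it a Fréchet space; ''dense'' and ''$G_\delta$'' refer to this topology. *)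

(* Defs.v *)
From HB Require Import structures.
From mathcomp Require Import all_boot all_order all_algebra.
From mathcomp Require Import all_classical all_reals all_analysis.
From mathcomp Require Import borel_hierarchy complex.

Set Implicit Arguments.
Unset Strict Implicit.
Unset Printing Implicit Defensive.

Import Order.TTheory GRing.Theory Num.Theory.
Import numFieldNormedType.Exports.

Local Open Scope classical_set_scope.
Local Open Scope ring_scope.

(* R[i] comes with no topology; give it the one induced by its modulus. *)
#[warnings="-redundant-canonical-projection"]
HB.instance Definition _ (R : realType) := NormedModule.copy R[i] R[i]^o.

Section Definitions.
Variable R : realType.
Local Notation C := R[i].

Definition domain (Omega : set C) : Prop :=
  [/\ Omega !=set0, open Omega & connected Omega].

Definition boundary (A : set C) : set C := closure A `\` interior A.

(* A rational function p / q with poles off D, as a function on D. Asking that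
   q has no zero in D is harmless: a rational function without poles in D is so
   represented by its reduced fraction, and conversely the poles of p / q are
   among the zeros of q. *)
Definition rational_off (D : set C) (r : set_type D -> C) : Prop :=
  exists p q : {poly C},
    (forall z : C, D z -> ~~ root q z) /\
    (forall z : set_type D, r z = p.[set_val z] / q.[set_val z]).

(* Functions on the subtype [closure Omega], with the library's topology of
   uniform convergence on the compact subsets of [closure Omega]. *)
Definition Rtilde (Omega : set C) :
    set {family compact, set_type (closure Omega) -> C} :=
  [set f | forall K : set (set_type (closure Omega)), compact K ->
     exists r : nat -> (set_type (closure Omega) -> C),
       (forall n, rational_off (r n)) /\ {uniform K, r @ \oo --> f}].

Arguments Rtilde Omega : clear implicits.

(* [Rtilde Omega], used as a type, carries the subspace topology of
   the function space above. *)
Definition Sclass (Omega J : set C) : set (set_type (Rtilde Omega)) :=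
  [set f | forall z0 : set_type (closure Omega), J (set_val z0) ->
     limf_esup
       (fun z : set_type (closure Omega) =>
          (ComplexField.Normc.normc
             ((set_val f z - set_val f z0) / (set_val z - set_val z0)))%:E)
       (within [set z | J (set_val z) /\ z <> z0] (nbhs z0))
     = +oo%E].

End Definitions.

Arguments Rtilde {R} Omega.
Arguments Sclass {R} Omega J.

(* Main.v *)
Require Import Defs.
From mathcomp Require Import all_boot all_order all_algebra.
From mathcomp Require Import all_classical all_reals all_analysis.
From mathcomp Require Import borel_hierarchy complex.
From mathcomp Require Import ring lra.
Import Order.TTheory GRing.Theory Num.Theory.
Import numFieldNormedType.Exports.
Local Open Scope classical_set_scope.
Local Open Scope ring_scope.

(** Call [f] steep at [z0] with slope [M] and range [e] when some [w] of [J],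
    distinct from [z0] and at distance less than [e] from it, satisfies
    [|f w - f z0| > M |w - z0|]. A function belongs to [Sclass Omega J] exactly
    when it is steep at every point of [J] for all [M] and all [e > 0]
    ([SclassP]).

    Density is algebraic. A rational function without poles on the closure of
    [Omega] is locally Lipschitz there ([rational_lipschitz_near]), so adding it
    to a member [f0] of the class changes the difference quotients near each
    point by a bounded amount and gives another member
    ([Sclass_add_rational]). Hence one member [f0] produces all the functions
    [f0 + r], [r] rational. They are dense: to approximate [f], take [r]
    close to [f - f0] on a compact set, as the definition of [Rtilde] allows
    ([Sclass_dense]).

    For the G_delta property, intersect over [n] the sets of functions that are
    steep at every point of [J] with slope [n] and range [1 / (n + 1)]. Each of
    them is open. Indeed steepness at [z0] is witnessed by a strict inequality
    between quantities that depend continuously on the point and on the function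
    together, because evaluation is jointly continuous on compact sets
    ([Rtilde_near_eval]); so it persists, with the same [w], for all points near
    [z0] and all functions near [f] ([steep_near]). Compactness of [J] turns
    this into one neighbourhood of [f] that serves all points of [J]
    ([Sclass_Gdelta]). *)

Set Implicit Arguments.
Unset Strict Implicit.
Unset Printing Implicit Defensive.

(** * The real-valued modulus and the topology of the complex plane *)

Section Modulus.
Variable R : realType.
Local Notation C := R[i].
Local Notation normc := (@ComplexField.Normc.normc R).

Lemma normc_ge0 (x : C) : 0 <= normc x.
Proof. by case: x => a b; exact: sqrtr_ge0. Qed.

Lemma normc_gt0 (x : C) : x != 0 -> 0 < normc x.
Proof.
move=> x0; rewrite lt_neqAle normc_ge0 andbT eq_sym.
by apply: contra_neq x0; exact: ComplexField.Normc.eq0_normc.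
Qed.

Lemma normc_opp (x : C) : normc (- x) = normc x.
Proof. exact: normcN. Qed.

Lemma normcBC (x y : C) : normc (x - y) = normc (y - x).
Proof. by rewrite -normc_opp opprB. Qed.

Lemma normcD_le (x y : C) : normc (x + y) <= normc x + normc y.
Proof. exact: le_normcD. Qed.

Lemma normcB_triangle (y x z : C) :
  normc (x - z) <= normc (x - y) + normc (y - z).
Proof. by rewrite -(subrKA y); exact: normcD_le. Qed.

Lemma normcB_le (x y : C) : normc x - normc y <= normc (x - y).
Proof. by rewrite lerBlDr -{1}(subrK y x); exact: normcD_le. Qed.

(** The radii of the balls of [C] are themselves complex numbers. This lemma and
    the next one replace them by real radii, for which order reasoning is
    total; a positive complex number is real, so nothing changes. *)
Lemma entourage_normcP (E : set (C * C)) :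
  entourage E <->
  exists2 e : R, 0 < e & forall x y : C, normc (x - y) < e -> E (x, y).
Proof.
rewrite -entourage_from_ballE; split.
- move=> [e /= e0 He]; exists (complex.Re e).
    by move: e0; rewrite ltcE /= => /andP[].
  move=> x y xy; apply: He; rewrite /ball /=.
  move: e0; rewrite ltcE /= => /andP[/eqP Ie _].
  by rewrite /ball_ /= /Num.norm /= ltcE /= Ie eqxx.
- move=> [e e0 He]; exists (e%:C)%C; first by rewrite /= ltcR.
  move=> [x y]; rewrite /= /ball /= /ball_ /= -[X in X < _]/((normc _)%:C)%C.
  by rewrite ltcR => /He.
Qed.

Lemma nbhs_normcP (D : set C) (z0 : set_type D) (A : set (set_type D)) :
  nbhs z0 A <->
  exists2 e : R, 0 < e &
    forall z, normc (set_val z0 - set_val z) < e -> A z.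
Proof.
split.
- move=> [_ [[U oU <-] Uz0 UA]].
  have : nbhs (set_val z0) U by exact: open_nbhs_nbhs.
  rewrite -nbhs_entourageE => -[E /entourage_normcP[e e0 He] EU].
  by exists e => // z /He Ez; apply/UA/EU/xsectionP.
- move=> [e e0 He].
  have nz0 : nbhs (set_val z0) [set y | normc (set_val z0 - y) < e].
    rewrite -nbhs_entourageE; exists [set xy | normc (xy.1 - xy.2) < e].
      by apply/entourage_normcP; exists e.
    by move=> y /xsectionP.
  have nz : nbhs z0 (set_val @^-1` [set y | normc (set_val z0 - y) < e]).
    exact: (@initial_continuous (set_type D) C set_val z0).
  by apply: filterS nz => z /He.
Qed.

End Modulus.

(** * Rational functions are locally Lipschitz off their poles *)

Section Rational.
Variable R : realType.
Local Notation C := R[i].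
Local Notation normc := (@ComplexField.Normc.normc R).

Lemma poly_bounded_near (p : {poly C}) (c : C) :
  exists2 B : R, 0 < B & forall z, normc (z - c) < 1 -> normc p.[z] <= B.
Proof.
elim/poly_ind: p => [|p a [B B0 IH]].
  by exists 1 => // z _; rewrite horner0 ComplexField.Normc.normc0.
exists (B * (normc c + 1) + normc a).
  by have := normc_ge0 c; have := normc_ge0 a; nra.
move=> z zc; rewrite !hornerE (le_trans (normcD_le _ _))// lerD2r.
rewrite ComplexField.Normc.normcM ler_pM ?normc_ge0 ?IH//.
by have := normcD_le (z - c) c; rewrite subrK; lra.
Qed.

Lemma horner_sub_factor (p : {poly C}) (c : C) :
  exists m : {poly C}, forall z, p.[z] - p.[c] = m.[z] * (z - c).
Proof.
have /factor_theorem[m pm] : root (p - p.[c]%:P) c.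
  by rewrite rootE !hornerE subrr.
by exists m => z; have := congr1 (horner^~ z) pm; rewrite !hornerE.
Qed.

(** With [c] the point [z0] and [r = p / q], one has
    [r z - r c = (p z * q c - p c * q z) / (q z * q c)]. The numerator is a
    polynomial in [z] that vanishes at [c], hence is [m z * (z - c)] with [m]
    bounded near [c], while [|q z| >= |q c| / 2] near [c]. *)
Lemma rational_lipschitz_near (D : set C) (r : set_type D -> C)
    (z0 : set_type D) :
  rational_off r ->
  exists B e : R, [/\ 0 < B, 0 < e & forall z,
    normc (set_val z - set_val z0) < e ->
    normc (r z - r z0) <= B * normc (set_val z - set_val z0)].
Proof.
move=> [p [q [q0 rE]]]; set c := set_val z0.
have nz (z : set_type D) : q.[set_val z] != 0.
  exact/q0/set_valP.
have [m mE] := horner_sub_factor (q.[c] *: p - p.[c] *: q) c.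
have [n nE] := horner_sub_factor q c.
have [M M0 Mb] := poly_bounded_near m c.
have [N N0 Nb] := poly_bounded_near n c.
have qc0 : 0 < normc q.[c] by apply/normc_gt0/nz.
set s := normc q.[c] in qc0.
(* Within distance [s / (2 * N)] of [c], the bound [N] on the slope of [q]
   keeps [|q|] above [s / 2], half its value at [c]. *)
exists (M / (s * (s / 2))), (Num.min 1 (s / (2 * N))).
have sN : 0 < s / (2 * N) by rewrite divr_gt0 ?mulr_gt0.
split.
- by rewrite divr_gt0 ?mulr_gt0 ?divr_gt0.
- by rewrite lt_min ltr01.
- move=> z; rewrite lt_min => /andP[z1 zN].
  have qz : s / 2 <= normc q.[set_val z].
    have := normcB_le q.[c] (q.[c] - q.[set_val z]).
    rewrite subKr normcBC nE ComplexField.Normc.normcM -/s.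
    have : N * normc (set_val z - c) <= s / 2.
      by move: (ltW zN); rewrite ler_pdivlMr ?mulr_gt0//; lra.
    have := Nb _ z1.
    have := normc_ge0 (set_val z - c); nra.
  have -> : r z - r z0 =
      m.[set_val z] * (set_val z - c) / (q.[c] * q.[set_val z]).
    rewrite -mE !rE -/c !hornerE; field.
    by rewrite ?nz ?(nz z0).
  rewrite !(ComplexField.Normc.normcM, ComplexField.Normc.normcV) -/s.
  rewrite mulrAC ler_wpM2r ?normc_ge0//.
  have s2 : 0 < s / 2 by rewrite divr_gt0.
  rewrite ler_pM ?normc_ge0 ?Mb//.
    by rewrite invr_ge0 mulr_ge0 ?normc_ge0// ltW.
  by rewrite lef_pV2 ?posrE ?mulr_gt0 ?ler_pM2l// (lt_le_trans s2).
Qed.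

Lemma rational_offD (D : set C) (r1 r2 : set_type D -> C) :
  rational_off r1 -> rational_off r2 -> rational_off (fun z => r1 z + r2 z).
Proof.
move=> [p1 [q1 [n1 E1]]] [p2 [q2 [n2 E2]]].
exists (p1 * q2 + p2 * q1), (q1 * q2); split=> [z Dz|z].
  by rewrite rootM negb_or n1 ?n2.
have Dz : D (set_val z) := set_valP z.
rewrite E1 E2 !hornerE; field.
by move: (n1 _ Dz) (n2 _ Dz); rewrite !rootE => -> ->.
Qed.

Lemma rational_offN (D : set C) (r : set_type D -> C) :
  rational_off r -> rational_off (fun z => - r z).
Proof.
move=> [p [q [n E]]]; exists (- p), q; split=> // z.
by rewrite E hornerN mulNr.
Qed.

End Rational.

(** * The function space and its topology *)

Section Rtilde.
Variable R : realType.
Local Notation C := R[i].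
Local Notation normc := (@ComplexField.Normc.normc R).
Variable Omega : set C.
Local Notation X := (set_type (closure Omega)).

(** Approximating sequences are traded for approximation within each [e]: a
    sequence is recovered by choosing an approximant for each [1 / (n + 1)]. *)
Lemma RtildeP (f : X -> C) :
  Rtilde Omega f <->
  forall (K : set X) (e : R), compact K -> 0 < e ->
    exists2 r : X -> C, rational_off r & forall z, K z -> normc (f z - r z) < e.
Proof.
split.
- move=> fR K e cK e0; have [r [rr rf]] := fR K cK.
  have /rf : nbhs (f : {uniform` K -> C})
      [set h | forall z, K z -> normc (f z - h z) < e].
    apply/uniform_nbhs; exists [set xy | normc (xy.1 - xy.2) < e].
    by split; [apply/entourage_normcP; exists e|].
  move=> [n _ Hn]; exists (r n); first exact: rr.
  exact: (Hn n (leqnn n)).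
- move=> H K cK.
  have e0 (n : nat) : 0 < n.+1%:R^-1 :> R by rewrite invr_gt0.
  have /choice[r rE] : forall n : nat, exists r : X -> C, rational_off r /\
      forall z, K z -> normc (f z - r z) < n.+1%:R^-1.
    by move=> n; have [r] := H K _ cK (e0 n); exists r.
  exists r; split=> [n|]; first by have [] := rE n.
  move=> W /uniform_nbhs[E [/entourage_normcP[e epos He] EW]].
  have : \forall n \near \oo, n.+1%:R^-1 < e.
    exact: near_infty_natSinv_lt (PosNum epos).
  apply: filterS => n ne; apply: EW => z Kz; apply: He.
  by apply: lt_trans ne; have [_] := rE n; apply.
Qed.

(** The topology is generated by the topologies of uniform convergence on
    single compact sets. A union of two compact sets is
    compact, so one compact set and one [e] already give a basic
    neighbourhood. *)
Lemma nbhs_RtildeP (f : set_type (Rtilde Omega))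
    (A : set (set_type (Rtilde Omega))) :
  nbhs f A <->
  exists (K : set X) (e : R), [/\ compact K, 0 < e &
    forall g : set_type (Rtilde Omega),
      (forall z, K z -> normc (set_val f z - set_val g z) < e) -> A g].
Proof.
split.
- move=> [_ [[U oU <-] Uf UA]].
  (* The candidate basic sets generate a filter [F] that converges to [f]
     uniformly on every compact set; hence [F] is finer than the neighbourhood
     filter of [f], and every neighbourhood contains a basic set. *)
  pose B (Ke : set X * R) : set (X -> C) :=
    [set g | forall z, Ke.1 z -> normc (set_val f z - g z) < Ke.2].
  pose F := filter_from [set Ke : set X * R | compact Ke.1 /\ 0 < Ke.2] B.
  have FF : Filter F.
    apply: filter_from_filter.
      by exists (set0, 1); split=> //; exact: compact0.
    move=> [K1 e1] [K2 e2] /= [c1 p1] [c2 p2].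
    exists (K1 `|` K2, Num.min e1 e2).
      by split=> /=; [exact: compactU|rewrite lt_min p1].
    move=> g Bg; split=> z Kz; have := Bg z; rewrite /= lt_min => H.
      by have /andP[] := H (or_introl Kz).
    by have /andP[] := H (or_intror Kz).
  have Ff : F --> (set_val f : {family compact, X -> C}).
    apply/fam_cvgP => K cK W /uniform_nbhs[E [/entourage_normcP[e e0 He] EW]].
    exists (K, e); first by [].
    by move=> g Bg; apply: EW => z Kz; apply/He/Bg.
  have : nbhs (set_val f : {family compact, X -> C}) U.
    exact: open_nbhs_nbhs.
  move=> /Ff[[K e] /= [cK e0] BU]; exists K, e; split=> // g fg.
  by apply/UA/BU.
- move=> [K [e [cK e0 HA]]].
  pose W : set {family compact, X -> C} := [set g | forall z, K z ->
    [set xy : C * C | normc (xy.1 - xy.2) < e] (set_val f z, g z)].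
  have nf : nbhs (set_val f : {family compact, X -> C}) W.
    by apply: fam_nbhs => //; apply/entourage_normcP; exists e.
  have ng : nbhs f (set_val @^-1` W).
    exact: (@initial_continuous (set_type (Rtilde Omega)) _ set_val f).
  by apply: filterS ng => g /HA.
Qed.

Lemma RtildeD_rational (f r : X -> C) :
  Rtilde Omega f -> rational_off r -> Rtilde Omega (fun z => f z + r z).
Proof.
move=> /RtildeP fR rr; apply/RtildeP => K e cK e0.
have [s sr fs] := fR K e cK e0.
exists (fun z => s z + r z); first exact: rational_offD.
by move=> z /fs; congr (normc _ < _); ring.
Qed.

(** Joint continuity, on a compact set, of the evaluation of a function at a
    point. As [f] is a uniform limit of rational functions on [K], its own
    continuity on [K] comes from that of one approximant [r]; four errors of
    size [e / 4] separate [g z] from [f z0], through [f z], [r z] and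
    [r z0]. *)
Lemma Rtilde_near_eval (K : set X) (f : set_type (Rtilde Omega)) (z0 : X)
    (e : R) : compact K -> K z0 -> 0 < e ->
  \forall z \near z0 & g \near f,
    K z -> normc (set_val g z - set_val f z0) < e.
Proof.
move=> cK Kz0 e0.
have fR : Rtilde Omega (set_val f) := set_valP f.
have e4 : 0 < e / 4 by lra.
have [r rr fr] := (RtildeP _).1 fR K (e / 4) cK e4.
have [B [d [B0 d0 Bd]]] := rational_lipschitz_near z0 rr.
exists ([set z | normc (set_val z0 - set_val z) < Num.min d (e / 4 / B)],
        [set g | forall z, K z -> normc (set_val f z - set_val g z) < e / 4]).
  split=> /=.
    apply/nbhs_normcP; exists (Num.min d (e / 4 / B)) => //.
    by rewrite lt_min d0 divr_gt0.
  by apply/nbhs_RtildeP; exists K, (e / 4).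
move=> [z g] /= [zz0 fg] Kz.
move: zz0; rewrite lt_min normcBC ltr_pdivlMr// => /andP[/Bd rz zB].
have h1 := fg _ Kz; rewrite normcBC in h1.
have h2 := fr _ Kz.
have h3 := fr _ Kz0; rewrite normcBC in h3.
have t1 := normcB_triangle (set_val f z) (set_val g z) (set_val f z0).
have t2 := normcB_triangle (r z) (set_val f z) (set_val f z0).
have t3 := normcB_triangle (r z0) (r z) (set_val f z0).
lra.
Qed.

End Rtilde.

(** * Points of infinite upper derivative *)

Lemma limf_esup_pinftyP (R : realType) (T : choiceType) (X : filteredType T)
    (h : X -> R) (F : set_system X) :
  limf_esup (fun x => (h x)%:E) F = +oo%E <->
  forall (V : set X) (M : R), F V -> exists2 x, V x & M < h x.
Proof.
rewrite limf_esupE; split.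
- move=> /ereal_inf_pinfty H V M FV.
  have : (M%:E < ereal_sup [set (h x)%:E | x in V])%E.
    by rewrite (H (ereal_sup _)) ?ltry//; exists V.
  by move=> /ereal_sup_gt[_ [x Vx <-]]; rewrite lte_fin; exists x.
- move=> H; apply/ereal_inf_pinfty => _ [V FV <-].
  apply: eq_infty => M; have [x Vx Mx] := H V M FV.
  by apply: le_ereal_sup_tmp; exists (h x)%:E; [exists x|rewrite lee_fin ltW].
Qed.

(** Compactness of [K] does not depend on whether [K] is seen in [T] or in a
    subspace [D] that contains it. A cluster point in [T] of the image filter
    lies in [K], hence comes from a point of [D], which is a cluster point for
    the subspace topology. *)
Lemma compact_preimage_set_val (T : topologicalType) (D K : set T) :
  K `<=` D -> compact K -> compact ((@set_val _ D) @^-1` K).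
Proof.
move=> KD cK F PF FK.
have [x [Kx clx]] := cK (set_val @ F) (fmap_proper_filter _ PF) FK.
have xE : set_val (exist _ x (mem_set (KD _ Kx)) : set_type D) = x.
  by rewrite set_valE.
exists (exist _ x (mem_set (KD _ Kx))); split; first by rewrite /= xE.
move=> A B FA [_ [[U oU <-] Ux UB]].
have [_ [[a Aa <-] Ua]] : (set_val @` A) `&` U !=set0.
  apply: clx; first by apply: (@filterS _ F _ A) FA => a Aa; exists a.
  by apply: open_nbhs_nbhs; split=> //; rewrite -xE.
by exists a; split=> //; exact: UB.
Qed.

Section Sclass.
Variable R : realType.
Local Notation C := R[i].
Local Notation normc := (@ComplexField.Normc.normc R).
Variables Omega J : set C.
Local Notation X := (set_type (closure Omega)).

(** A product in place of a difference quotient, so that the inequality makes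
    sense for all pairs of points and perturbs without division. *)
Definition steep (M e : R) (f : X -> C) (z0 : X) : Prop :=
  exists w : X, [/\ J (set_val w), w <> z0,
    normc (set_val z0 - set_val w) < e &
    M * normc (set_val w - set_val z0) < normc (f w - f z0)].

Lemma normc_set_val_gt0 (w z : X) : w <> z -> 0 < normc (set_val w - set_val z).
Proof.
move=> wz; apply: normc_gt0; rewrite subr_eq0; apply/eqP => E.
by apply: wz; apply: val_inj; rewrite -!set_valE.
Qed.

Lemma SclassP (f : set_type (Rtilde Omega)) :
  Sclass Omega J f <->
  forall z0 : X, J (set_val z0) ->
    forall M e : R, 0 < e -> steep M e (set_val f) z0.
Proof.
have quotE (M : R) (w z0 : X) : w <> z0 ->
  (M < normc ((set_val f w - set_val f z0) / (set_val w - set_val z0))) =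
  (M * normc (set_val w - set_val z0) < normc (set_val f w - set_val f z0)).
  move=> wz; rewrite ComplexField.Normc.normcM ComplexField.Normc.normcV.
  by rewrite ltr_pdivlMr// normc_set_val_gt0.
split=> H z0 Jz0.
- move=> M e e0; have /limf_esup_pinftyP := H z0 Jz0.
  move=> /(_ [set w | normc (set_val z0 - set_val w) < e /\
                      (J (set_val w) /\ w <> z0)] M)[|w [dw [Jw wz]] Mw].
    by apply/nbhs_normcP; exists e.
  by exists w; split=> //; rewrite -quotE.
- apply/limf_esup_pinftyP => V M /nbhs_normcP[e e0 eV].
  have [w [Jw wz dw Mw]] := H z0 Jz0 M e e0.
  by exists w; [exact: eV|rewrite quotE].
Qed.

(** If [r] has Lipschitz constant [B] near [z0], a point [w] where [f] is steep
    with slope [M + B] is one where [f + r] is steep with slope [M]. *)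
Lemma Sclass_add_rational (f g : set_type (Rtilde Omega)) (r : X -> C) :
  Sclass Omega J f -> rational_off r ->
  (forall z, set_val g z = set_val f z + r z) -> Sclass Omega J g.
Proof.
move=> /SclassP fS rr gE; apply/SclassP => z0 Jz0 M e e0.
have [B [d [B0 d0 rB]]] := rational_lipschitz_near z0 rr.
have [|w [Jw wz]] := fS z0 Jz0 (M + B) (Num.min e d).
  by rewrite lt_min e0.
rewrite lt_min => /andP[we wd] fw; exists w; split=> //.
have rw : normc (r w - r z0) <= B * normc (set_val w - set_val z0).
  by apply: rB; rewrite normcBC.
have -> : set_val g w - set_val g z0 =
    (set_val f w - set_val f z0) - (- (r w - r z0)) by rewrite !gE; ring.
have := normcB_le (set_val f w - set_val f z0) (- (r w - r z0)).
by rewrite normc_opp; lra.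
Qed.

Lemma Sclass_dense : Sclass Omega J !=set0 -> dense (Sclass Omega J).
Proof.
move=> [f0 f0S] O [f Of] oO.
have /nbhs_RtildeP[K [e [cK e0 KO]]] : nbhs f O by exact: open_nbhs_nbhs.
have inR (h : set_type (Rtilde Omega)) : Rtilde Omega (set_val h) := set_valP h.
have e2 : 0 < e / 2 by lra.
have [r rr fr] := (RtildeP _).1 (inR f) K (e / 2) cK e2.
have [s sr f0s] := (RtildeP _).1 (inR f0) K (e / 2) cK e2.
have tr : rational_off (fun z => r z + - s z).
  by apply: rational_offD => //; exact: rational_offN.
have gR := RtildeD_rational (inR f0) tr.
pose g : set_type (Rtilde Omega) :=
  exist (fun h => h \in Rtilde Omega) _ (mem_set gR).
have gE z : set_val g z = set_val f0 z + (r z + - s z) by [].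
exists g; split; last exact: Sclass_add_rational gE.
apply: KO => z Kz; rewrite gE.
have -> : set_val f z - (set_val f0 z + (r z - s z)) =
    (set_val f z - r z) - (set_val f0 z - s z) by ring.
have := normcD_le (set_val f z - r z) (- (set_val f0 z - s z)).
rewrite normc_opp.
by have := fr _ Kz; have := f0s _ Kz; lra.
Qed.

Lemma steep_near (f : set_type (Rtilde Omega)) (M e : R) (z0 : X) :
  compact ((@set_val _ (closure Omega)) @^-1` J) -> J (set_val z0) ->
  0 <= M -> steep M e (set_val f) z0 ->
  \forall z \near z0 & g \near f, J (set_val z) -> steep M e (set_val g) z.
Proof.
set K := _ @^-1` J => cK Jz0 M0 [w [Jw wz dw Mw]].
set D := normc (set_val f w - set_val f z0) - M * normc (set_val w - set_val z0).
have D0 : 0 < D by rewrite subr_gt0.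
have D3 : 0 < D / 3 by lra.
have w0 := normc_set_val_gt0 wz.
have near_f := Rtilde_near_eval f cK Jz0 D3.
have near_w : \forall g \near f, normc (set_val f w - set_val g w) < D / 3.
  by apply/nbhs_RtildeP; exists [set w], (D / 3); split=> //;
    [exact: compact_set1|move=> g; exact].
(* [d] keeps [z] different from [w], then within range [e] of [w], and makes
   [M * |z - z0|] smaller than a third of the margin [D]; the other two thirds
   absorb the changes of value at [z] and at [w]. The [+ 1] keeps the
   denominator positive when [M] is [0]. *)
pose d := Num.min (normc (set_val w - set_val z0))
  (Num.min (e - normc (set_val z0 - set_val w)) (D / (3 * (M + 1)))).
have M1 : 0 < 3 * (M + 1) by lra.
have d0 : 0 < d by rewrite !lt_min w0 subr_gt0 dw divr_gt0.
have near_z : \forall z \near z0, normc (set_val z0 - set_val z) < d.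
  by apply/nbhs_normcP; exists d.
have near_zg : \forall z \near z0 & g \near f,
    normc (set_val z0 - set_val z) < d /\
    normc (set_val f w - set_val g w) < D / 3.
  by exists ([set z : X | normc (set_val z0 - set_val z) < d],
    [set g : set_type (Rtilde Omega) |
      normc (set_val f w - set_val g w) < D / 3]) => // -[z g] [].
apply: filterS2 near_f near_zg => -[z g] /= fg [+ gw] Jz.
have gz := fg Jz.
rewrite !lt_min ltr_pdivlMr// => /and3P[zw ze zD].
have t0 := normcB_triangle (set_val z0) (set_val w) (set_val z).
have t1 := normcB_triangle (set_val z0) (set_val z) (set_val w).
rewrite (normcBC (set_val z) (set_val z0)) in t1.
exists w; split=> //.
- by move=> wE; move: zw; rewrite wE normcBC ltxx.
- by lra.
- have t2 := normcB_triangle (set_val g w) (set_val f w) (set_val f z0).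
  have t3 := normcB_triangle (set_val g z) (set_val g w) (set_val f z0).
  have := normc_ge0 (set_val z0 - set_val z).
  have : M * normc (set_val w - set_val z) <=
      M * (normc (set_val w - set_val z0) + normc (set_val z0 - set_val z)).
    by rewrite ler_wpM2l.
  rewrite /D in zD gw gz *; lra.
Qed.

Lemma Sclass_Gdelta : J `<=` closure Omega -> compact J ->
  Gdelta (Sclass Omega J).
Proof.
move=> JO /(compact_preimage_set_val JO) cK.
exists (fun n : nat => [set f : set_type (Rtilde Omega) |
  forall z : X, J (set_val z) -> steep n%:R n.+1%:R^-1 (set_val f) z]).
- move=> n; rewrite openE => f fn.
  have /compact_near_coveringP/near_covering_withinP cover := cK.
  apply: (cover _ (nbhs f) (fun g z => steep n%:R n.+1%:R^-1 (set_val g) z)).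
  move=> z Jz; apply: steep_near => //; exact: fn.
- apply/seteqP; split=> f.
    move=> /SclassP fS n _ z Jz; exact: fS.
  move=> fn; apply/SclassP => z Jz M e e0.
  have [k _ ke] := near_infty_natSinv_lt (PosNum e0).
  pose n := maxn k (Num.truncn M).+1.
  have [w [Jw wz dw nw]] := fn n I z Jz.
  exists w; split=> //.
    by apply: lt_trans dw _; apply: ke; exact: leq_maxl.
  apply: le_lt_trans nw; rewrite ler_wpM2r ?normc_ge0//.
  apply: (le_trans (ltW (truncnS_gt M))).
  by rewrite ler_nat leq_maxr.
Qed.

End Sclass.

Theorem theorem3p1 (R : realType) (Omega J : set R[i])
    (Omega_domain : domain Omega) (Omega_unbounded : ~ bounded_set Omega)
    (J_boundary : J `<=` boundary Omega) (J_compact : compact J)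
    (J_no_isolated : isolated J = set0) :
  Sclass Omega J = set0 \/ (dense (Sclass Omega J) /\ Gdelta (Sclass Omega J)).
Proof.
have [->|/set0P S0] := eqVneq (Sclass Omega J) set0; first by left.
right; split; first exact: Sclass_dense.
by apply: Sclass_Gdelta => // z /J_boundary[].
Qed.
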